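(* Consider the multi-objective problem $$\text{(P)}\quad \operatorname*{minimize}_{(r_0,t_f)\in\mathcal I\times[0,\infty)} J(r_0,t_f)\quad\text{subject to } (r_0,t_f)\in\Gamma,$$ with $J(r_0,t_f)=[\Delta m,\ t_f]^T\in\mathbb R^2$, where $\Delta m$ is the 7th component of $r_0$. Then (P) is equivalent to $$\text{(P')}\quad \operatorname*{minimize}_{(r_0,t_f)\in\mathcal I\times[0,\infty)} J(r_0,t_f)\quad\text{subject to } \omega(r_0,t_f)\le 0,$$ where $$\omega(r_0,t_f)=\inf_{(\mathbf r,\mathbf u)\in\Pi_{r_0,t_f}}\max\Big\{\nu(\mathbf r(0)),\ \max_{\tau\in[-t_f,0]}g(\mathbf r(\tau))\Big\}.$$ That is, the two problems have the same objective and the same feasible set: for every $(r_0,t_f)\in\mathcal I\times[0,\infty)$, $$(r_0,t_f)\in\Gamma\iff\omega(r_0,t_f)\le 0.$$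
   Context: Controls: $T_{\max}>0$, $\mathcal U=[-\pi,\pi]\times[-\tfrac{\pi}{2},\tfrac{\pi}{2}]\times[0,T_{\max}]$, and $\mathcal U_{ad}$ is the set of Lebesgue measurable functions from $(-\infty,0]$ to $\mathcal U$. Dynamics: $f:\mathbb R^7\times\mathcal U\to\mathbb R^7$ (in the paper, the vector field of a spacecraft with state $r=(\rho,\theta,\psi,v_\rho,v_t,v_\perp,\Delta m)$). Standing assumptions: $f$ is continuous and bounded; there is $L_f>0$ such that $\|f(r_1,u)-f(r_2,u)\|\le L_f\|r_1-r_2\|$ for all $r_1,r_2\in\mathbb R^7$, $u\in\mathcal U$; for every $r\in\mathcal K$ the set $\{f(r,u):u\in\mathcal U\}$ is a compact convex subset of $\mathbb R^7$. Sets: $\mathcal K=\{r\in\mathbb R^7:\rho\in[\rho_{\min},\rho_{\max}],\ \Delta m\in[m_{\min},m_{\max}]\}$, where $\rho$ and $\Delta m$ are the first and seventh components of $r$, $0<\rho_{\min}<\rho_{\max}$ and $0=m_{\min}<m_{\max}$. The target set $\mathcal C\subset\mathcal K$ and the initial set $\mathcal I\subset\mathcal K$ are closed. Trajectories: for $r_0\in\mathbb R^7$, $t_f\ge0$, $\Pi_{r_0,t_f}$ is the set of pairs $(\mathbf r,\mathbf u)$ with $\mathbf u\in\mathcal U_{ad}$ and $\mathbf r:[-t_f,0]\to\mathbb R^7$ absolutely continuous, $\dot{\mathbf r}(t)=f(\mathbf r(t),\mathbf u(t))$ for a.e. $t\in[-t_f,0]$, and $\mathbf r(-t_f)=r_0$.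 $\Pi^{\mathcal K,\mathcal C}_{r_0,t_f}$ is the set of $(\mathbf r,\mathbf u)\in\Pi_{r_0,t_f}$ with $\mathbf r(t)\in\mathcal K$ for all $t\in[-t_f,0]$ and $\mathbf r(0)\in\mathcal C$. Finally $\Gamma=\{(r_0,t_f)\in\mathbb R^7\times[0,\infty):\Pi^{\mathcal K,\mathcal C}_{r_0,t_f}\ne\emptyset\}$. Level-set functions: $g,\nu:\mathbb R^7\to\mathbb R$ are Lipschitz functions with $g(r)\le0\iff r\in\mathcal K$ and $\nu(r)\le0\iff r\in\mathcal C$. *)

(* Defs.v *)
From HB Require Import structures.
From mathcomp Require Import all_boot all_order all_algebra.
From mathcomp Require Import all_classical all_reals all_analysis.
From mathcomp Require Import measurable_realfun.
Set Implicit Arguments.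
Unset Strict Implicit.
Unset Printing Implicit Defensive.
Import Order.TTheory GRing.Theory Num.Theory.
Import numFieldNormedType.Exports.
Local Open Scope classical_set_scope.
Local Open Scope ring_scope.

(* R^7 is 'rV[R]_7 with the library's norm, the sup norm.  A function on an
   interval is a total function on R whose values outside it are irrelevant. *)

(* A minimization problem whose costs may be vectors. *)
Record problem (X V : Type) := Problem
  { decision : set X ; cost : X -> V ; constraint : set X }.

Definition feasible X V (P : problem X V) : set X :=
  decision P `&` constraint P.

Definition same_problem X V (P Q : problem X V) : Prop :=
  cost P =1 cost Q /\ feasible P = feasible Q.

(* R with the Lebesgue sigma-algebra: Borel sets modified by null sets. *)
Notation lebesgueR R :=
  (g_sigma_algebraType (completed_algebra_gen (@lebesgue_measure R))).

Section defs.
Context {R : realType}.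

Definition rho (r : 'rV[R]_7) : R := r 0 ord0.
Definition dm (r : 'rV[R]_7) : R := r 0 ord_max.

Definition ctrl_set (Tmax : R) : set (R * R * R) :=
  `[- pi, pi] `*` `[- (pi / 2), pi / 2] `*` `[0, Tmax].

Definition state_set (rho_min rho_max m_min m_max : R) : set 'rV[R]_7 :=
  [set r | rho_min <= rho r <= rho_max /\ m_min <= dm r <= m_max].

Definition admissible (Tmax : R) : set (R -> R * R * R) :=
  [set u | measurable_fun (`]-oo, 0] : set (lebesgueR R))
             (u : lebesgueR R -> R * R * R) /\
           forall t, t <= 0 -> ctrl_set Tmax (u t)].

Definition abs_continuous (a b : R) (h : R -> 'rV[R]_7) : Prop :=
  forall e : R, 0 < e -> exists2 d : R, 0 < d &
    forall (n : nat) (s t : 'I_n -> R),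
      (forall i, [/\ a <= s i, s i <= t i & t i <= b]) ->
      trivIset setT (fun i => `]s i, t i[%classic) ->
      \sum_(i < n) (t i - s i) < d ->
      \sum_(i < n) `|h (t i) - h (s i)| < e.

(* The derivative is two-sided, hence depends on values of the trajectory outside
   [- tf, 0] at the endpoints only, which are negligible. *)
Definition trajectories (f : 'rV[R]_7 -> R * R * R -> 'rV[R]_7) (Tmax : R)
    (r0 : 'rV[R]_7) (tf : R) : set ((R -> 'rV[R]_7) * (R -> R * R * R)) :=
  [set ru | [/\ admissible Tmax ru.2,
     abs_continuous (- tf) 0 ru.1,
     {ae lebesgue_measure, forall t : R, t \in `[- tf, 0] ->
        is_derive t 1 ru.1 (f (ru.1 t) (ru.2 t))} &
     ru.1 (- tf) = r0]].

Definition feasible_trajectories f Tmax (K C : set 'rV[R]_7) r0 tf :=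
  trajectories f Tmax r0 tf `&`
  [set ru | (forall t, t \in `[- tf, 0] -> K (ru.1 t)) /\ C (ru.1 0)].

Definition Gamma f Tmax (K C : set 'rV[R]_7) : set ('rV[R]_7 * R) :=
  [set x | 0 <= x.2 /\ feasible_trajectories f Tmax K C x.1 x.2 !=set0].

(* [sup] is a maximum here, see [running_max_attained]. *)
Definition running_max (g : 'rV[R]_7 -> R) (tf : R) (r : R -> 'rV[R]_7) : R :=
  sup [set g (r t) | t in `[- tf, 0]].

(* Extended-real valued, so that the infimum of the empty set would be +oo. *)
Definition omega f Tmax (g nu : 'rV[R]_7 -> R) r0 tf : \bar R :=
  ereal_inf [set (Num.max (nu (ru.1 0)) (running_max g tf ru.1))%:E
            | ru in trajectories f Tmax r0 tf].

Lemma abs_continuous_within (a b : R) (h : R -> 'rV[R]_7) :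
  abs_continuous a b h -> {within `[a, b], continuous h}.
Proof.
move=> ach; apply/subspace_continuousP => x abx.
apply/cvgrPdist_lt => e e0; have [d d0 hd] := ach e e0.
have key u v : a <= u -> v <= b -> u <= v -> v - u < d -> `|h u - h v| < e.
  move=> au vb uv uvd.
  have := hd 1%N (fun=> u) (fun=> v); rewrite !big_ord1 distrC; apply => //.
  by move=> i j _ _ _; rewrite (ord1 i) (ord1 j).
rewrite near_withinE; near=> y => /= aby.
have xyd : `|x - y| < d.
  by near: y; apply: (@cvgr_dist_lt _ _ _ (nbhs x)) => //; exact: cvg_id.
move: abx aby; rewrite /= !in_itv /= => /andP[ax xb] /andP[ay yb].
have [xy|/ltW yx] := leP x y.
  by apply: key => //; rewrite (le_lt_trans _ xyd)// distrC ler_norm.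
by rewrite distrC; apply: key => //; rewrite (le_lt_trans _ xyd)// ler_norm.
Unshelve. all: by end_near. Qed.

Lemma running_max_attained (g : 'rV[R]_7 -> R) (tf : R) (r : R -> 'rV[R]_7) :
  0 <= tf -> lipschitz g -> abs_continuous (- tf) 0 r ->
  exists2 c, c \in `[- tf, 0] & running_max g tf r = g (r c) /\
    forall t, t \in `[- tf, 0] -> g (r t) <= g (r c).
Proof.
move=> tf0 [M [_ lipM]] /abs_continuous_within cr.
have {}lipM := lipM (`|M| + 1) _.
have {}lipM x y : `|g x - g y| <= (`|M| + 1) * `|x - y|.
  by apply: (lipM _ (x, y)) => //; rewrite (le_lt_trans (ler_norm M))// ltrDl.
have cg : continuous g.
  move=> x; apply/(cvgrPdist_lt (FF := nbhs_filter x)) => e e0.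
  have M0 : 0 < `|M| + 1 by rewrite ltr_wpDl.
  apply: (filterS _ (nbhsx_ballx x _ (divr_gt0 e0 M0))) => y.
  rewrite -ball_normE /= => xy; rewrite (le_lt_trans (lipM _ _))//.
  by rewrite mulrC -ltr_pdivlMr.
have cgr : {within `[- tf, 0], continuous (g \o r)}.
  by apply: within_continuous_comp => // x _; exact: cg.
have [|c cI cmax] := EVT_max _ cgr; first by rewrite oppr_le0.
exists c => //; split => //; apply/le_anti/andP; split.
  apply: ge_sup; first by exists (g (r c)), c.
  by move=> _ [t tI <-]; exact: cmax.
by apply: ub_le_sup; [exists (g (r c)) => _ [t tI <-]; exact: cmax|exists c].
Qed.

Definition objective (x : 'rV[R]_7 * R) : 'cV[R]_2 :=
  \col_(i < 2) (if i == 0 then dm x.1 else x.2).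

Definition problemP f Tmax (K C Init : set 'rV[R]_7) :=
  Problem [set x | Init x.1 /\ 0 <= x.2] objective (Gamma f Tmax K C).

Definition problemP' f Tmax (g nu : 'rV[R]_7 -> R) (Init : set 'rV[R]_7) :=
  Problem [set x | Init x.1 /\ 0 <= x.2] objective
    [set x | omega f Tmax g nu x.1 x.2 <= 0]%E.

End defs.

(* Main.v *)
Require Import Defs.
From HB Require Import structures.
From mathcomp Require Import all_boot all_order all_algebra.
From mathcomp Require Import all_classical all_reals all_analysis.
From mathcomp Require Import measurable_realfun.
From mathcomp Require Import ring lra.
Set Implicit Arguments.
Unset Strict Implicit.
Unset Printing Implicit Defensive.
Import Order.TTheory GRing.Theory Num.Theory.
Import numFieldNormedType.Exports.
Local Open Scope classical_set_scope.
Local Open Scope ring_scope.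

(* If omega <= 0, take trajectories q_n along which nu and g are at most 1/(n+1).
   They are equi-Lipschitz, so they converge pointwise along an ultrafilter to some
   r, which is Lipschitz, stays in K and ends in C.  At a point t where r is
   differentiable, a difference quotient of q_n over [t, t + h] is almost a convex
   combination of velocities f (q_n s) u with q_n s close to r t, so r'(t) lies in
   the compact convex set f (r t) U; this uses convexity only at the limit state
   r t, which belongs to K, and pointwise convergence suffices.  A measurable control
   realising r' is then selected by minimizing one coordinate after the other
   (Filippov). *)

(** * Mean value inclusion for absolutely continuous curves *)

(* Cousin's lemma. *)
Lemma interval_chain (R : realType) (a b : R) (Q : R -> R -> Prop) : a <= b ->
  (forall s t w, a <= s -> s <= t -> t <= w -> w <= b ->
     Q s t -> Q t w -> Q s w) ->
  (forall x, a <= x -> x <= b -> exists2 d : R, 0 < d & forall s t,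
     a <= s -> x - d < s -> s <= x -> x <= t -> t < x + d -> t <= b -> Q s t) ->
  Q a b.
Proof.
move=> ab Qcat Qloc.
pose S := [set x | [/\ a <= x, x <= b & Q a x]].
have Sa : S a.
  have [d d0 Qd] := Qloc a (lexx a) ab.
  by split => //; apply: Qd => //; lra.
have ubS : has_ubound S by exists b => x [].
have supS : has_sup S by split => //; exists a.
have ac : a <= sup S by exact: ub_le_sup.
have cb : sup S <= b by apply: ge_sup; [exists a|move=> x []].
have [d d0 Qd] := Qloc _ ac cb.
have [x [ax xb Qax] cdx] := sup_adherent d0 supS.
have xc : x <= sup S by apply: ub_le_sup.
(* A point [x] of [S] within [d] of [sup S] can be joined to any [y] just beyond [sup S]. Hence
   [sup S < b] is absurd, for [sup S + d / 2] would lie in [S]. *)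
have Sy y : sup S <= y -> y < sup S + d -> y <= b -> S y.
  move=> cy ycd yb; split => //; first exact: le_trans cy.
  by apply: (Qcat a x y) => //; [exact: le_trans cy|exact: Qd].
have [bcd|cdb] := ltP b (sup S + d); first by have [] := Sy b cb bcd (lexx b).
have : S (sup S + d / 2) by apply: Sy; lra.
by move=> /(ub_le_sup ubS); lra.
Qed.

Lemma is_derive_approx (R : realType) (V : normedModType R) (h : R -> V)
    (x : R) (d : V) (e : R) : is_derive x 1 h d -> 0 < e ->
  exists2 r : R, 0 < r & forall y, `|y - x| < r ->
    `|h y - h x - (y - x) *: d| <= e * `|y - x|.
Proof.
move=> [dh <-] e0; have /cvgrPdist_le /(_ e e0) := dh.
rewrite -/('D_1 h x) => -[r /= r0 hr]; exists r => // y yxr.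
have [->|yx] := eqVneq y x; first by rewrite !subrr scale0r subr0 !normr0 mulr0.
have yx0 : y - x != 0 by rewrite subr_eq0.
have := hr (y - x); rewrite /ball_ /= sub0r normrN => /(_ yxr yx0).
rewrite scaler1 subrK => hyx.
rewrite -ler_pdivrMr ?normr_gt0// mulrC -normfV -normrZ.
by rewrite scalerBr scalerA mulVf// scale1r distrC.
Qed.

(** Since [x] lies between [s] and [t], the first-order errors on its two sides, [e * (x - s)] and
    [e * (t - x)], add up to exactly [e * (t - s)]. *)
Lemma straddle (R : realType) (V : normedModType R) (h : R -> V)
    (x : R) (d : V) (e : R) : is_derive x 1 h d -> 0 < e ->
  exists2 r : R, 0 < r & forall s t, x - r < s -> s <= x -> x <= t ->
    t < x + r -> `|h t - h s - (t - s) *: d| <= e * (t - s).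
Proof.
move=> hd e0; have [r r0 hr] := is_derive_approx hd e0; exists r => // s t *.
have -> : h t - h s - (t - s) *: d =
    (h t - h x - (t - x) *: d) - (h s - h x - (s - x) *: d).
  have -> : (t - s) *: d = (t - x) *: d - (s - x) *: d.
    by rewrite -scalerBl; congr (_ *: _); ring.
  move: (h t) (h s) (h x) ((t - x) *: d) ((s - x) *: d) => u v w p q.
  by rewrite !opprD !opprK !addrA [RHS](ACl (1*4*3*6*(2*5)))/= addNr addr0.
rewrite (le_trans (ler_normB _ _))//.
have -> : e * (t - s) = e * `|t - x| + e * `|s - x|.
  by rewrite ger0_norm ?subr_ge0// ler0_norm ?subr_le0//; ring.
by apply: lerD; apply: hr; [rewrite ger0_norm|rewrite ler0_norm]; lra.
Qed.

(** Ordered lists concatenate when adjacent intervals are glued, unlike families indexed by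
    ordinals; the ordering gives the disjointness. *)
Lemma abs_continuous_seq (R : realType) (a b : R) (h : R -> 'rV[R]_7) (e : R) :
  abs_continuous a b h -> 0 < e -> exists2 d : R, 0 < d &
    forall l : seq (R * R), all (fun p => [&& a <= p.1, p.1 <= p.2 & p.2 <= b]) l ->
      pairwise (fun p q => p.2 <= q.1) l -> \sum_(p <- l) (p.2 - p.1) < d ->
      \sum_(p <- l) `|h p.2 - h p.1| < e.
Proof.
move=> ach e0; have [d d0 hd] := ach e e0; exists d => // l /all_nthP lab lp ld.
pose s (i : 'I_(size l)) := (nth (0, 0) l i).1.
pose t (i : 'I_(size l)) := (nth (0, 0) l i).2.
have := hd (size l) s t.
rewrite (big_nth (0, 0)) big_mkord in ld.
rewrite (big_nth (0, 0)) big_mkord; apply => //.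
  by move=> i; have /and3P[] := lab (0, 0) i (ltn_ord i).
have disj (i j : 'I_(size l)) x : (i < j)%N ->
    `]s i, t i[%classic x -> `]s j, t j[%classic x -> False.
  move=> ij; rewrite /= !in_itv/= => /andP[_ xi] /andP[jx _].
  have /(pairwiseP (0, 0))/(_ i j) := lp.
  rewrite !inE !ltn_ord => /(_ isT isT ij) tisj.
  by have := lt_trans jx (lt_le_trans xi tisj); rewrite ltxx.
move=> i j _ _ [x [xi xj]]; apply/val_inj.
by case: (ltngtP i j) => // ij; [case: (disj _ _ x ij)|case: (disj _ _ x ij)].
Qed.

Lemma negligible_open_cover (R : realType) (N : set R) (e : R) :
  (@lebesgue_measure R).-negligible N -> 0 < e ->
  exists U : set R, [/\ open U, N `<=` U & (lebesgue_measure U < e%:E)%E].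
Proof.
move=> [B [mB B0 NB]] e0.
have [|U [oU BU Ue]] := lebesgue_regularity_outer mB _ e0.
  by rewrite [X in (X < _)%E](_ : _ = 0%E)// ltry.
exists U; split => //; first exact: subset_trans BU.
have mU : measurable U by exact: open_measurable.
rewrite -(setDKU BU) measureU//; [|exact: measurableD|by rewrite setDKI].
by rewrite [X in (_ + X)%E](_ : _ = 0%E)// adde0.
Qed.

Section measure_in_itv.
Context {R : realType} (O : set R).
Hypothesis mO : measurable O.
(** Half-open intervals make [m] additive over adjacent intervals; [fine] loses nothing, as the
    measure is at most that of []s, t]]. *)
Let m (s t : R) : R := fine (lebesgue_measure (O `&` `]s, t])).

Let mOI (s t : R) : measurable (O `&` `]s, t]).
Proof. exact: measurableI. Qed.

Let mE s t : lebesgue_measure (O `&` `]s, t]) = (m s t)%:E.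
Proof.
rewrite fineK// ge0_fin_numE//.
rewrite (@le_lt_trans _ _ (lebesgue_measure (`]s, t] : set R)))//.
  apply: le_measure; rewrite ?inE; last exact: subIsetr.
    exact: mOI.
  exact: measurable_itv.
by rewrite lebesgue_measure_itv/=; case: ifP => _; rewrite ?ltry.
Qed.

Lemma measure_in_itv_cat s t w : s <= t -> t <= w -> m s w = m s t + m t w.
Proof.
move=> st tw; apply: EFin_inj; rewrite EFinD -!mE -measureU//.
  rewrite -setIUr; congr (lebesgue_measure (_ `&` _)).
  apply/seteqP; split => x /=; rewrite !in_itv/=.
    by move=> /andP[sx xw]; have [xt|tx] := leP x t; [left; rewrite sx|right].
  case=> /andP[]; first by move=> -> /le_trans->.
  by move=> /(le_lt_trans st) -> ->.
- exact: mOI.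
- exact: mOI.
apply/seteqP; split => x //= -[[_]] + [_].
by rewrite !in_itv/= => /andP[_ xt] /andP[/(le_lt_trans xt)]; rewrite ltxx.
Qed.

Lemma measure_in_itv_ge0 s t : 0 <= m s t.
Proof. exact: fine_ge0. Qed.

Lemma measure_in_itv_sub s t : s <= t -> `]s, t] `<=` O -> m s t = t - s.
Proof.
move=> st stO; apply: EFin_inj; rewrite -mE setIidr//.
rewrite lebesgue_measure_itv/= lte_fin; case: ltP => [//|ts].
by rewrite (@le_anti _ _ s t) ?st// subrr.
Qed.

Lemma measure_in_itv_le s t (e : R) : (lebesgue_measure O <= e%:E)%E -> m s t <= e.
Proof.
by move=> Oe; rewrite -lee_fin -mE; apply: le_trans Oe; apply: le_measure;
  rewrite ?inE; [exact: mOI|exact: mO|exact: subIsetl].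
Qed.
End measure_in_itv.

(** Cousin's lemma takes the place of integration. The straddle lemma yields a velocity in [A] near
    each point of differentiability, convexity merges the velocities of adjacent intervals, and the
    other points are covered by an open set of small measure on which [h] varies little. *)
Lemma ac_mean_value (R : realType) (a b : R) (h : R -> 'rV[R]_7)
    (A : set 'rV[R]_7) (e : R) :
  a <= b -> abs_continuous a b h ->
  (forall x y k, 0 <= k -> k <= 1 -> A x -> A y -> A (k *: x + (1 - k) *: y)) ->
  A !=set0 ->
  {ae lebesgue_measure, forall t : R, t \in `[a, b] ->
     exists2 d, A d & is_derive t 1 h d} ->
  0 < e -> exists2 z, A z & `|h b - h a - (b - a) *: z| <= e.
Proof.
move=> ab ach convA [z0 Az0] aeA e0.
(* The error splits into [e / 2] for the straddle terms, [e / 4] for the increments of [h] inside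
   the cover and [e / 4] for the [z0] terms there. The [+ 1] allows [a = b]. *)
pose eta := e / 2 / (b - a + 1).
have ba1 : 0 < b - a + 1 by lra.
have eta0 : 0 < eta by rewrite divr_gt0// divr_gt0.
have etaba : eta * (b - a) <= e / 2.
  by rewrite /eta -mulrA ger_pMr ?divr_gt0// ler_pdivrMl// mulr1; lra.
have e4 : 0 < e / 4 by lra.
have [d1 d10 hd1] := abs_continuous_seq ach e4.
pose d := Num.min d1 (e / 4 / (`|z0| + 1)).
have z01 : 0 < `|z0| + 1 by rewrite ltr_wpDl.
have d0 : 0 < d by rewrite lt_min d10 divr_gt0.
have dz0 : d * `|z0| <= e / 4.
  have : d <= e / 4 / (`|z0| + 1) by rewrite ge_min lexx orbT.
  rewrite ler_pdivlMr// => H; apply: le_trans H.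
  by apply: ler_wpM2l; [exact: ltW|rewrite lerDl].
have [W [oW NW Wd]] := negligible_open_cover aeA d0.
have mW : measurable W by exact: open_measurable.
pose m (s t : R) : R := fine (lebesgue_measure (W `&` `]s, t])).
(* l lists the subintervals inside W, where the derivative may fail to exist;
   their total contribution is small by absolute continuity. *)
pose Q (s t : R) := exists z (l : seq (R * R)), [/\ A z,
  pairwise (fun p q : R * R => p.2 <= q.1) l,
  all (fun p => [&& s <= p.1, p.1 <= p.2 & p.2 <= t]) l,
  \sum_(p <- l) (p.2 - p.1) <= m s t &
  `|h t - h s - (t - s) *: z| <=
    eta * (t - s) + \sum_(p <- l) (`|h p.2 - h p.1| + (p.2 - p.1) * `|z0|)].
have Qcat s t w : a <= s -> s <= t -> t <= w -> w <= b ->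
    Q s t -> Q t w -> Q s w.
  move=> _ st tw _ [z1 [l1 [Az1 l1p /allP l1a l1m l1z]]]
    [z2 [l2 [Az2 l2p /allP l2a l2m l2z]]].
  have [z Az Ez] : exists2 z, A z &
      (w - s) *: z = (t - s) *: z1 + (w - t) *: z2.
    (* The merged velocity is the average weighted by lengths; the weights make no sense when
       [s = w], where any velocity will do. *)
    have [sw|sw] := eqVneq s w.
      have ts : t = s by apply/le_anti; rewrite st {1}sw tw.
      by exists z1 => //; rewrite -sw ts !subrr !scale0r addr0.
    have ws : 0 < w - s by rewrite subr_gt0 lt_neqAle sw (le_trans st).
    exists ((t - s) / (w - s) *: z1 + (1 - (t - s) / (w - s)) *: z2).
      apply: convA => //; first by rewrite divr_ge0 ?subr_ge0// (le_trans st).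
      by rewrite ler_pdivrMr// mul1r; lra.
    rewrite scalerDr !scalerA mulrBr mulr1 mulrC divfK ?gt_eqF//.
    by congr (_ + _ *: _); ring.
  exists z, (l1 ++ l2); split => //.
  - rewrite pairwise_cat l1p l2p !andbT; apply/allrelP => p q /l1a /and3P[_ _ pt].
    by move=> /l2a /and3P[tq _ _]; exact: le_trans tq.
  - rewrite all_cat; apply/andP; split; apply/allP => p.
      by move=> /l1a /and3P[-> -> /le_trans ->].
    by move=> /l2a /and3P[/(le_trans st) -> -> ->].
  - by rewrite big_cat/= /m (measure_in_itv_cat mW st tw); exact: lerD.
  - rewrite big_cat/= Ez.
    have -> : h w - h s - ((t - s) *: z1 + (w - t) *: z2) =
       (h t - h s - (t - s) *: z1) + (h w - h t - (w - t) *: z2).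
      rewrite opprD !addrA [RHS](ACl (4*2*3*6*(1*5)))/= subrr addr0.
      by [].
    rewrite (le_trans (ler_normD _ _))//; apply: le_trans (lerD l1z l2z) _.
    by rewrite addrACA -mulrDr [t - s + _]addrC [w - t + _]addrA subrK.
have Qloc x : a <= x -> x <= b -> exists2 d : R, 0 < d & forall s t,
     a <= s -> x - d < s -> s <= x -> x <= t -> t < x + d -> t <= b -> Q s t.
  move=> ax xb; have [Wx|Wx] := pselect (W x).
    (* Near a point of the cover, the whole interval goes into the list and the arbitrary [z0]
       serves as velocity. *)
    have /nbhs_ballP[r /= r0 rW] := open_nbhs_nbhs (conj oW Wx).
    exists r => // s t _ xrs sx xt txr _.
    have stW : `]s, t] `<=` W.
      move=> y /=; rewrite in_itv/= => /andP[sy yt]; apply: rW.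
      by rewrite /ball/= ltr_distlC; apply/andP; split; lra.
    have st : s <= t by exact: le_trans xt.
    exists z0, [:: (s, t)]; split => //=.
    - by rewrite !lexx st.
    - by rewrite big_seq1/= /m (measure_in_itv_sub mW).
    - rewrite big_seq1/= (le_trans (ler_normB _ _))//.
      by rewrite normrZ ger0_norm ?subr_ge0// lerDr mulr_ge0 ?subr_ge0// ltW.
  (* Off the cover the derivative exists and lies in [A], so the list stays empty. *)
  have [d' Ad' hd'] : exists2 d, A d & is_derive x 1 h d.
    by apply: contrapT => nd; apply/Wx/NW => /(_ _)/nd; apply; rewrite in_itv/= ax.
  have [r r0 hr] := straddle hd' eta0.
  exists r => // s t _ xrs sx xt txr _.
  exists d', [::]; split => //=; rewrite !big_nil; first exact: measure_in_itv_ge0.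
  by rewrite addr0 hr.
have [z [l [Az lp la lm lz]]] := interval_chain ab Qcat Qloc.
have ld : \sum_(p <- l) (p.2 - p.1) < d.
  apply: le_lt_trans lm _.
  have Wfin : (lebesgue_measure W) \is a fin_num.
    by rewrite ge0_fin_numE// (lt_trans Wd)// ltry.
  have : (lebesgue_measure W <= (fine (lebesgue_measure W))%:E)%E.
    by rewrite fineK.
  move=> /(measure_in_itv_le mW a b)/le_lt_trans; apply.
  by rewrite -lte_fin fineK.
exists z => //; apply: le_trans lz _.
have l1 : \sum_(p <- l) `|h p.2 - h p.1| < e / 4.
  by apply: hd1 => //; apply: lt_le_trans ld _; rewrite ge_min lexx.
rewrite big_split/= -mulr_suml.
have : (\sum_(p <- l) (p.2 - p.1)) * `|z0| <= d * `|z0|.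
  by rewrite ler_wpM2r// ltW.
lra.
Qed.

(** * Almost everywhere differentiability of Lipschitz curves *)

Section monotone_derivable.
Context {R : realType} (F : R -> R).
Hypothesis ndF : {homo F : x y / x <= y}.
Hypothesis ndIF : {homo (fun x => x - F x) : x y / x <= y}.

Let lipF x y : `|F x - F y| <= `|x - y|.
Proof.
wlog xy : x y / x <= y.
  by move=> H; have [/H//|/ltW/H] := leP x y; rewrite distrC (distrC y).
have := ndF xy; have /= := ndIF xy.
by rewrite !ler0_norm ?subr_le0//; [lra|exact: ndF].
Qed.

Let contF : continuous F.
Proof.
move=> x; apply/cvgrPdist_lt => e e0; near=> y.
rewrite (le_lt_trans (lipF _ _))//; near: y.
Unshelve. all: end_near. Qed.

Let contIF : continuous (fun x => x - F x).
Proof. by move=> x; apply: cvgB; [exact: cvg_id|exact: contF]. Qed.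

Let G1 : cumulative R R := HB.pack F
  (isCumulative.Build R _ R F ndF (right_continuousW contF)).
Let G2 : cumulative R R := HB.pack (fun x => x - F x)
  (isCumulative.Build R _ R (fun x => x - F x) ndIF (right_continuousW contIF)).

Let lsE (G : cumulative R R) (a b : R) : a <= b ->
  lebesgue_stieltjes_measure G `]a, b] = (G b - G a)%:E.
Proof.
move=> ab; rewrite /lebesgue_stieltjes_measure/= /measure_extension/=.
rewrite measurable_mu_extE/=; last exact: is_ocitv.
by rewrite wlength_itv_bnd.
Qed.

(** The Stieltjes measures of [F] and of [x - F x] add up to Lebesgue measure, since on []a, b]]
    their values sum to [b - a]. *)
Let ls_le (A : set R) : measurable A ->
  (lebesgue_stieltjes_measure G1 A <= lebesgue_measure A)%E.
Proof.
move=> mA.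
have -> : lebesgue_measure A = measure_add (lebesgue_stieltjes_measure G1)
   (lebesgue_stieltjes_measure G2) A.
  apply: lebesgue_measure_unique => // _ [[a b] _ <-] /=.
  have [ab|ba] := leP a b; last first.
    by rewrite set_itv_ge ?measure0// bnd_simp -leNgt ltW.
  apply: etrans (lsE _ ab) _; apply/esym.
  apply: etrans (measure_addE _ _ _) _.
  apply: etrans (congr2 (fun x y => x + y)%E (lsE G1 ab) (lsE G2 ab)) _.
  by rewrite -EFinD/=; congr EFin; ring.
by rewrite measure_addE leeDl.
Qed.

(** The Stieltjes measure of [F] is dominated by Lebesgue measure, so it has a Radon-Nikodym
    density. [F] is locally an integral of this density, and Lebesgue differentiation applies. *)
Lemma nondecreasing_contraction_ae_derivable :
  {ae lebesgue_measure, forall x, derivable F x 1}.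
Proof.
(* On a bounded window the Stieltjes measure is finite; countably many windows cover the line. *)
suff H N : {ae lebesgue_measure, forall x, - N%:R < x < N%:R -> derivable F x 1}.
  have := ae_foralln H; apply: filterS => x Fx.
  have [N xN] : exists N, `|x| < N%:R.
    by exists (Num.truncn `|x|).+1; exact: truncnS_gt.
  by apply: (Fx N); rewrite -ltr_norml.
have mD : measurable (`]- N%:R, N%:R] : set R) by exact: measurable_itv.
have NN : - N%:R <= N%:R :> R by rewrite ge0_cp.
have muD : (lebesgue_stieltjes_measure G1 `](- N%:R)%R, N%:R%R] < +oo)%E.
  by rewrite lsE// ltry.
pose nu : {finite_measure set (measurableTypeR R) -> \bar R} :=
  @mfrestr _ (measurableTypeR R) _ _ _ mD muD.
have dom : nu `<< lebesgue_measure.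
  apply/null_content_dominatesP => A mA A0; apply/eqP.
  rewrite eq_le measure_ge0 andbT -A0 (le_trans _ (ls_le mA))//.
  rewrite /nu /mfrestr /mrestr.
  by apply: le_measure; rewrite ?inE; [exact: measurableI|exact: mA|exact: subIsetl].
have [f [f0 ffin intf nuE]] :=
  @radon_nikodym_sigma_finite _ _ R lebesgue_measure nu dom.
have fE : EFin \o (fine \o f) = f.
  by apply/funext => x; rewrite /= fineK.
have intf' (A : set R) : measurable A ->
    lebesgue_measure.-integrable A (EFin \o (fine \o f)).
  by move=> mA; rewrite fE; apply: (integrableS measurableT).
have loc : locally_integrable [set: R] (fine \o f).
  by apply: open_integrable_locally; [exact: openT|exact: intf'].
have := @FTC1 R (fine \o f) (BRight (- N%:R))
  (fun y => intf' _ (measurable_itv _)) loc.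
apply: filterS; first exact: (ae_filter_ringOfSetsType lebesgue_measure).
move=> x H /andP[xN Nx].
have [] := H; first by rewrite lte_fin.
set I := (fun y => _) => dI _.
(* Inside the window [F] is the integral of the density plus the constant [F (- N%:R)]. *)
have FE : {near x, (fun y => I y + F (- N%:R)) =1 F}.
  have /near_in_itvoo : x \in `]- N%:R, N%:R[ by rewrite in_itv/= xN Nx.
  apply: filterS => y; rewrite in_itv/= => /andP[/ltW Ny /ltW yN].
  rewrite /I /Rintegral -/(EFin \o (fine \o f)) fE -nuE; last exact: measurable_itv.
  rewrite (_ : nu _ = lebesgue_stieltjes_measure G1
    (`]- N%:R, y]%classic `&` `]- N%:R, N%:R]%classic))// setIidl; last first.
    by move=> z /=; rewrite !in_itv/= => /andP[-> /le_trans->].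
  by rewrite lsE//= subrK.
apply: near_eq_derivable FE _.
by apply: derivableD; [exact: dI|exact: derivable_cst].
Qed.
End monotone_derivable.

(** Adding [M * x] makes [F] nondecreasing with slopes at most [2 * M]; dividing by [2 * M] brings
    it to the monotone case. *)
Lemma lipschitz_ae_derivable (R : realType) (F : R -> R) (M : R) : 0 < M ->
  (forall x y, `|F x - F y| <= M * `|x - y|) ->
  {ae lebesgue_measure, forall x, derivable F x 1}.
Proof.
move=> M0 lipF; have M20 : 0 < (2 * M)^-1 by rewrite invr_gt0 mulr_gt0.
pose G x := (2 * M)^-1 * (F x + M * x).
have FG : F = (fun x => (2 * M) * G x - M * x).
  by apply/funext => x; rewrite /G mulrA mulfV ?mul1r ?addrK// gt_eqF// mulr_gt0.
have FM x y : x <= y -> - (M * (y - x)) <= F y - F x <= M * (y - x).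
  by move=> xy; rewrite -ler_norml (le_trans (lipF _ _))// ger0_norm ?subr_ge0.
have ndG : {homo G : x y / x <= y}.
  by move=> x y /FM; rewrite /G => H; rewrite ler_pM2l//; lra.
have ndIG : {homo (fun x => x - G x) : x y / x <= y}.
  move=> x y /FM H.
  have E z : z - G z = (2 * M)^-1 * (M * z - F z).
    by rewrite /G; field; rewrite gt_eqF.
  by rewrite !E ler_pM2l//; lra.
have := nondecreasing_contraction_ae_derivable ndG ndIG.
apply: filterS; first exact: (ae_filter_ringOfSetsType lebesgue_measure).
move=> x dG; rewrite FG.
have d1 : derivable (cst (2 * M) * G) x 1.
  by apply: derivableM dG; exact: derivable_cst.
have d2 : derivable (cst M * @id R) x 1.
  by apply: derivableM; [exact: derivable_cst|exact: derivable_id].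
have := derivableB d1 d2.
exact.
Qed.

Lemma lipschitz_rV_ae_derivable (R : realType) n (r : R -> 'rV[R]_n.+1) (M : R) :
  0 < M -> (forall x y, `|r x - r y| <= M * `|x - y|) ->
  {ae lebesgue_measure, forall x, derivable r x 1}.
Proof.
move=> M0 lipr.
have H (j : 'I_n.+1) :
    {ae lebesgue_measure, forall x, derivable (fun x => r x 0 j) x 1}.
  apply: (lipschitz_ae_derivable M0) => x y; apply: le_trans (lipr x y).
  have -> : r x 0 j - r y 0 j = (r x - r y) 0 j by rewrite !mxE.
  rewrite [leRHS]/Num.norm/= mx_normrE.
  exact: (@le_bigmax _ _ _ (0 : R) (fun ij => `|(r x - r y) ij.1 ij.2|) (0, j)).
have aeF := ae_filter_ringOfSetsType (@lebesgue_measure R).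
have := filter_forall aeF H; apply: filterS => x dx.
by apply/derivable_mxP => i j; rewrite (ord1 i).
Qed.

(** * Pointwise limits along an ultrafilter *)

(** One ultrafilter containing all tails gives a limit at every point at once. Approximation at [s],
    at [t] and [N <= n] are three sets of this filter, so a common index exists. *)
Lemma pointwise_cluster (R : realType) (V : normedModType R) (T : Type)
    (q : nat -> T -> V) (K : set V) :
  compact K -> (forall n t, K (q n t)) ->
  exists r : T -> V, forall (e : R) s t N, 0 < e ->
    exists n, [/\ (N <= n)%N, `|q n s - r s| < e & `|q n t - r t| < e].
Proof.
move=> cK Kq; have [F [UF ooF]] := ultraFilterLemma (@eventually_filter).
have H t : exists x : V, q n t @[n --> F] --> x.
  move: cK; rewrite compact_ultra => /(_ (q n t @[n --> F]))[].
  - split=> [|G GF qFG]; first exact: fmap_proper_filter.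
    (* The image of an ultrafilter is an ultrafilter: one of the preimages of [A] and of its
       complement belongs to [F]. *)
    apply/seteqP; split => // A GA.
    have [//|nA] := in_ultra_setVsetC (q ^~ t @^-1` A) UF.
    have /filter_ex [x [Ax nAx]] : G (A `&` ~` A) by apply: filterI => //; exact: qFG.
    by [].
  - rewrite /nbhs/=; apply: (filterS (P := setT)); last exact: filterT.
    by move=> n _; exact: Kq.
  by move=> x [Kx qx]; exists x.
exists (fun t => sval (cid (H t))) => e s t N e0.
have /cvgrPdist_lt /(_ e e0) qs := svalP (cid (H s)).
have /cvgrPdist_lt /(_ e e0) qt := svalP (cid (H t)).
have NF : F [set n | (N <= n)%N] by apply: ooF; exists N.
have [n [[/= sn tn] Nn]] := filter_ex (filterI (filterI qs qt) NF).
by exists n; rewrite !(distrC (q _ _)).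
Qed.

(** * Measurable selection *)

Lemma compact_within_preimage (X Y : topologicalType) (U : set X) (h : X -> Y)
    (C : set Y) :
  compact U -> {within U, continuous h} -> closed C -> compact (U `&` h @^-1` C).
Proof.
move=> + /subspace_continuousP hU cC; rewrite !compact_ultra => cU F UF FUC.
have FU : F U by apply: filterS FUC => x [].
have [x [Ux Fx]] := cU F UF FU.
exists x; split => //; split => //; apply: cC => B Bx.
have FB : F (h @^-1` B).
  by have := Fx _ (hU x Ux B Bx); apply: filterS2 FU => y Uy; exact.
by have [y [[_ Cy] By]] := filter_ex (filterI FUC FB); exists (h y).
Qed.

Section measurable_argmin.
Context {d} {T : measurableType d} {X : topologicalType} {R : realType}.
Implicit Types (S : T -> set X) (p : X -> R).

(** The lower inverse image of [B] under the multifunction [S]. *)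
Definition hit S (B : set X) : set T := [set t | S t `&` B !=set0].

Definition hit_measurable S :=
  (forall t, compact (S t)) /\ forall B, closed B -> measurable (hit S B).

Definition minval S p t := inf (p @` S t).

Definition argmin S p t := S t `&` p @^-1` [set minval S p t].

Let minvalP S p t : hit_measurable S -> continuous p -> S t !=set0 ->
  exists2 x, S t x & p x = minval S p t /\ forall y, S t y -> p x <= p y.
Proof.
move=> [cS _] cp St0.
have [|x /set_mem Sx xmin] := compact_EVT_min (f := p) St0 (cS t).
  exact: continuous_subspaceT.
have {}xmin y : S t y -> p x <= p y by move=> Sy; apply: xmin; exact/mem_set.
exists x => //; split => //; apply/le_anti/andP; split.
  by apply: lb_le_inf; [exists (p x), x|move=> _ [y Sy <-]; exact: xmin].
apply: ge_inf; last by exists x.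
by exists (p x) => _ [y Sy <-]; exact: xmin.
Qed.

Lemma argmin_nonempty S p t : hit_measurable S -> continuous p ->
  S t !=set0 -> argmin S p t !=set0.
Proof. by move=> mS cp /(minvalP mS cp)[x Sx [px _]]; exists x. Qed.

Let closed_le p (c : R) : continuous p -> closed [set x | p x <= c].
Proof.
move=> cp; rewrite (_ : [set x | _] = p @^-1` `]-oo, c]%classic).
  by apply: closed_comp => //; exact: (@interval_closed _ `]-oo, c]).
by apply/seteqP; split => x /=; rewrite in_itv.
Qed.

(** The domain is where [S t] is nonempty, so that the infimum is a true minimum. It exceeds [c]
    exactly when [S t] misses the closed set where [p <= c]. *)
Lemma measurable_minval S p : hit_measurable S -> continuous p ->
  measurable_fun (hit S setT) (minval S p).
Proof.
move=> mS cp mD; apply: (measurability _ (RGenOInfty.measurableE R)) => //.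
move=> _ [_ [c ->] <-].
rewrite (_ : _ `&` _ = hit S setT `\` hit S [set x | p x <= c]).
  apply: measurableD => //; apply: mS.2; exact: closed_le.
have hitT t : hit S setT t <-> S t !=set0 by rewrite /hit /= setIT.
apply/seteqP; split => t [/[dup] + /hitT /(minvalP mS cp)[x Sx [px xmin]]];
  move=> ht; rewrite /= in_itv/= andbT -px.
  move=> cpx; split => // -[y [Sy /= pyc]].
  by have := xmin y Sy; lra.
move=> nh; split => //; rewrite ltNge; apply/negP => pxc; apply: nh.
by exists x.
Qed.

(** The minimizers meet [B] exactly when the minimum over [S t] intersected with [B] is at most the
    minimum over [S t], a comparison of two measurable functions. *)
Lemma hit_measurable_argmin S p : hit_measurable S -> continuous p ->
  hit_measurable (argmin S p).
Proof.
move=> mS cp; split => [t|B cB].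
  apply: compact_closedI; first exact: mS.1.
  by apply: closed_comp => //; exact: closed_eq.
pose SB t := S t `&` B.
have mSB : hit_measurable SB.
  split => [t|B' cB']; first by apply: compact_closedI => //; exact: mS.1.
  rewrite (_ : hit SB B' = hit S (B `&` B')); first by apply: mS.2; exact: closedI.
  by apply/seteqP; split => t; rewrite /hit/= /SB setIA.
have mD : measurable (hit SB setT) by apply: mSB.2; exact: closedT.
rewrite (_ : hit _ _ = hit SB setT `&` [set t | minval SB p t <= minval S p t]).
  apply: measurable_fun_le => //; first exact: measurable_minval.
  apply: measurable_funS (measurable_minval mS cp); first exact/mS.2/closedT.
  by move=> t [x [[Sx _] _]]; exists x.
apply/seteqP; split => t.
  move=> [x [[Sx /= px] Bx]]; split; first by exists x.
  have [|y [Sy By] [<- ymin]] := minvalP mSB cp (t := t); first by exists x.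
  by rewrite /= -px ymin.
move=> [[x [[Sx Bx] _]]].
have [|y [Sy By] [/= <- ymin]] := minvalP mSB cp (t := t); first by exists x.
have [|z Sz [/= <- zmin]] := minvalP mS cp (t := t); first by exists x.
move=> yz; exists y; split => //; split => //=.
have [|z' Sz' [/= <- zmin']] := minvalP mS cp (t := t); first by exists x.
by have := zmin y Sy; have := zmin z' Sz'; have := zmin' z Sz; lra.
Qed.

End measurable_argmin.

(** The selection is the lexicographically least point of [S t]: after three minimizations its
    coordinates are the successive minimal values, each measurable in [t]. *)
Lemma measurable_selection d (T : measurableType d) (R : realType)
    (S : T -> set (R * R * R)) :
  hit_measurable S -> (forall t, S t !=set0) ->
  exists2 u : T -> R * R * R, measurable_fun setT u & forall t, S t (u t).
Proof.
move=> mS S0.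
pose p1 (x : R * R * R) := x.1.1; pose p2 (x : R * R * R) := x.1.2.
pose p3 (x : R * R * R) := x.2.
have c1 : continuous p1.
  by move=> x; apply: continuous_comp; [exact: cvg_fst|exact: cvg_fst].
have c2 : continuous p2.
  by move=> x; apply: continuous_comp; [exact: cvg_fst|exact: cvg_snd].
have c3 : continuous p3 by move=> x; exact: cvg_snd.
pose S1 := argmin S p1; pose S2 := argmin S1 p2; pose S3 := argmin S2 p3.
have mS1 := hit_measurable_argmin mS c1.
have mS2 := hit_measurable_argmin mS1 c2.
have S10 t := argmin_nonempty mS c1 (S0 t).
have S20 t := argmin_nonempty mS1 c2 (S10 t).
have S30 t := argmin_nonempty mS2 c3 (S20 t).
have hitT (Q : T -> set (R * R * R)) : (forall t, Q t !=set0) -> hit Q setT = setT.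
  by move=> Q0; apply/seteqP; split => // t _; rewrite /hit/= setIT.
exists (fun t => (minval S p1 t, minval S1 p2 t, minval S2 p3 t)).
  apply: measurable_fun_pair; first apply: measurable_fun_pair.
  - by rewrite -(hitT _ S0); exact: measurable_minval.
  - by rewrite -(hitT _ S10); exact: measurable_minval.
  - by rewrite -(hitT _ S20); exact: measurable_minval.
move=> t; have [[[x1 x2] x3]] := S30 t.
by move=> [[[Sx /= <-] /= <-] /= <-].
Qed.

(** * Distance from a vector to a set of velocities *)

Section residual.
Context {R : realType} {V : normedModType R} {X : topologicalType}.
Variables (f : V -> X -> V) (L : R) (W : set X).
Hypotheses (W0 : W !=set0) (cW : compact W).
Hypothesis cf : forall y, {within W, continuous (f y)}.
Hypothesis lf : forall y1 y2 u, W u -> `|f y1 u - f y2 u| <= L * `|y1 - y2|.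

(** Turns the inclusion of [z] in the velocities at [y] into an inequality between real functions,
    from which measurability follows. *)
Definition residual y z : R := inf [set `|f y u - z| | u in W].

Lemma residualP y z :
  exists2 u, W u & residual y z = `|f y u - z|.
Proof.
have cfz : {within W, continuous (fun u => `|f y u - z|)}.
  move=> u; apply: cvg_norm; apply: cvgB; [exact: cf|exact: cvg_cst].
have [u /set_mem Wu umin] := compact_EVT_min W0 cW cfz.
exists u => //; apply/le_anti/andP; split.
  by apply: ge_inf; [exists 0 => _ [v _ <-]; exact: normr_ge0|exists u].
apply: lb_le_inf; first by exists `|f y u - z|, u.
by move=> _ [v Wv <-]; apply: umin; exact/mem_set.
Qed.

Lemma residual_le y z u : W u -> residual y z <= `|f y u - z|.
Proof.
by move=> Wu; apply: ge_inf; [exists 0 => _ [v _ <-]; exact: normr_ge0|exists u].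
Qed.

Lemma residual_le0 y z : residual y z <= 0 <-> exists2 u, W u & f y u = z.
Proof.
split=> [|[u Wu <-]]; last first.
  by rewrite (le_trans (residual_le _ _ Wu))// subrr normr0.
have [u Wu ->] := residualP y z; rewrite normr_le0 subr_eq0 => /eqP fyu.
by exists u.
Qed.

(** An optimal control for one pair is a competitor for the other. *)
Lemma residual_lipschitz y z y' z' :
  `|residual y z - residual y' z'| <= L * `|y - y'| + `|z - z'|.
Proof.
have H y1 z1 y2 z2 :
    residual y1 z1 <= residual y2 z2 + (L * `|y1 - y2| + `|z1 - z2|).
  have [u Wu ->] := residualP y2 z2; apply: le_trans (residual_le _ _ Wu) _.
  have -> : f y1 u - z1 = (f y2 u - z2) + ((f y1 u - f y2 u) + (z2 - z1)).
    by rewrite !addrA [RHS](ACl (3*6*(1*4)*(2*5)))/= subrr addr0 addNr addr0.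
  rewrite (le_trans (ler_normD _ _))// lerD2l (le_trans (ler_normD _ _))//.
  by apply: lerD; [exact: lf|rewrite distrC].
rewrite ler_distlC; apply/andP; split.
  by rewrite lerBlDr; exact: H.
by rewrite (distrC y) (distrC z); exact: H.
Qed.

End residual.

Lemma lipschitz_continuous1 (R : realType) (F : R -> R) (M : R) :
  (forall x y, `|F x - F y| <= M * `|x - y|) -> continuous F.
Proof.
move=> lF x; apply/cvgrPdist_lt => e e0.
have M0 : 0 < `|M| + 1 by rewrite ltr_wpDl.
near=> y; rewrite (le_lt_trans (lF _ _))//.
have : (`|M| + 1) * `|x - y| < e.
  rewrite mulrC -ltr_pdivlMr//; near: y.
  by apply: (@cvgr_dist_lt _ _ _ (nbhs x)) (divr_gt0 e0 M0); exact: cvg_id.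
apply: le_lt_trans; rewrite ler_wpM2r//.
by rewrite (le_trans (ler_norm M))// lerDl.
Unshelve. all: by end_near. Qed.

(** Presents the derivative as the limit of a sequence of functions continuous in [t] when [r] is,
    which yields measurability. *)
Lemma cvg_difference_quotient (R : realType) (V : normedModType R) (r : R -> V)
    (t : R) : derivable r t 1 ->
  n.+1%:R *: (r (t + n.+1%:R^-1) - r t) @[n --> \oo] --> 'D_1 r t.
Proof.
move=> /derivableP dr; apply/cvgrPdist_le => e e0.
have [d d0 hd] := is_derive_approx dr e0.
near=> n; have n0 : 0 < n.+1%:R :> R by [].
have nd : n.+1%:R^-1 < d by near: n; exact: near_infty_natSinv_lt (PosNum d0).
have := hd (t + n.+1%:R^-1); rewrite [_ + _ - t]addrC addKr.
rewrite ger0_norm ?invr_ge0// => /(_ nd) H; rewrite distrC.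
rewrite -(ler_pM2l (x := n.+1%:R^-1)) ?invr_gt0// [leRHS]mulrC.
rewrite -[X in X * `|_|]gtr0_norm ?invr_gt0// -normrZ scalerBr scalerA.
by rewrite mulVf ?gt_eqF// scale1r.
Unshelve. all: by end_near. Qed.

(** Filippov's lemma: the controls realising the velocity form a compact-valued measurable
    multifunction, from which a measurable selection is taken. *)
Lemma measurable_velocity_selection (R : realType) (V : normedModType R)
    (f : V -> R * R * R -> V) (U : set (R * R * R)) (r : R -> V) (G : set R)
    (L M : R) :
  compact U -> U !=set0 -> (forall y, {within U, continuous (f y)}) ->
  (forall y1 y2 u, U u -> `|f y1 u - f y2 u| <= L * `|y1 - y2|) ->
  0 <= L -> (forall s t, `|r s - r t| <= M * `|s - t|) ->
  measurable G -> (forall t, G t -> derivable r t 1) ->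
  (forall t, G t -> [set f (r t) u | u in U] ('D_1 r t)) ->
  exists2 u : R -> R * R * R, measurable_fun setT u &
    forall t, U (u t) /\ (G t -> f (r t) (u t) = 'D_1 r t).
Proof.
move=> cU [u0 Uu0] cf lf L0 lr mG dr velU.
(* Outside [G] a fixed control keeps the multifunction nonempty. *)
pose S t := if t \in G then U `&` f (r t) @^-1` [set 'D_1 r t] else [set u0].
have mhit B : closed B ->
    measurable (G `&` [set t | exists2 u, (U `&` B) u & f (r t) u = 'D_1 r t]).
  move=> cB; have [W0|W0] := pselect (U `&` B !=set0); last first.
    rewrite (_ : _ `&` _ = set0); first exact: measurable0.
    by apply/seteqP; split => // t [_ [u UBu _]]; apply: W0; exists u.
  have cW : compact (U `&` B) by exact: compact_closedI.
  have cfW y : {within U `&` B, continuous (f y)}.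
    by apply: continuous_subspaceW (cf y) => u [].
  have lfW y1 y2 u : (U `&` B) u -> `|f y1 u - f y2 u| <= L * `|y1 - y2|.
    by move=> [Uu _]; exact: lf.
  pose res := residual f (U `&` B).
  have resL := residual_lipschitz W0 cW cfW lfW.
  have mres : measurable_fun G (fun t => res (r t) ('D_1 r t)).
    (* With the difference quotient in place of the derivative, the residual is Lipschitz in [t];
       its limit over [n] is therefore measurable on [G]. *)
    pose D n t := n.+1%:R *: (r (t + n.+1%:R^-1) - r t).
    apply: (@measurable_fun_cvg _ _ _ _ (fun n t => res (r t) (D n t))).
      move=> n; apply: measurable_funTS; apply: continuous_measurable_fun.
      apply: (@lipschitz_continuous1 _ _ (L * M + n.+1%:R * (M + M))) => s t.
      apply: le_trans (resL _ _ _ _) _; rewrite mulrDl -mulrA.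
      apply: lerD; first exact: ler_wpM2l.
      rewrite /D -scalerBr normrZ ger0_norm// -mulrA ler_wpM2l//.
      rewrite opprD opprK addrACA (le_trans (ler_normD _ _))//.
      rewrite mulrDl; apply: lerD; last by rewrite addrC distrC; exact: lr.
      by apply: le_trans (lr _ _) _; rewrite opprD addrACA subrr addr0.
    move=> t Gt; apply/cvgrPdist_le => e e0.
    have /cvgrPdist_le /(_ e e0) := cvg_difference_quotient (dr t Gt).
    apply: filterS => n; apply: le_trans; apply: le_trans (resL _ _ _ _) _.
    by rewrite subrr normr0 mulr0 add0r.
  have := measurable_fun_le mG mres (@measurable_cst _ _ R R G 0).
  congr (measurable (_ `&` _)); apply/seteqP; split => t /=.
    by move=> /(residual_le0 W0 cW cfW).
  by move=> /(residual_le0 W0 cW cfW).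
have mS : hit_measurable S.
  split => [t|B cB].
    rewrite /S; case: ifPn => _; last exact: compact_set1.
    apply: compact_within_preimage => //.
    exact/accessible_closed_set1/hausdorff_accessible/norm_hausdorff.
  rewrite (_ : hit S B = (G `&` [set t | exists2 u, (U `&` B) u &
      f (r t) u = 'D_1 r t]) `|` (~` G `&` [set t | B u0])).
    apply: measurableU; first exact: mhit.
    apply: measurableI; first exact: measurableC.
    have [Bu0|Bu0] := pselect (B u0).
      by rewrite (_ : [set _ | _] = setT)//; apply/seteqP; split.
    by rewrite (_ : [set _ | _] = set0)//; apply/seteqP; split.
  apply/seteqP; split => t.
    rewrite /hit/= /S; case: ifPn => [/set_mem Gt [u [[Uu /= fu] Bu]]|].
      by left; split => //; exists u.
    by move=> /negP nG [_ [-> Bu0]]; right; split => // Gt; apply: nG; exact/mem_set.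
  case=> [[Gt [u [Uu Bu] fu]]|[nG Bu0]]; rewrite /hit/= /S.
    by rewrite mem_set//; exists u.
  by rewrite memNset//; exists u0.
have S0 t : S t !=set0.
  rewrite /S; case: ifPn => [/set_mem Gt|_]; last by exists u0.
  by have [u Uu fu] := velU t Gt; exists u.
have [u mu Su] := measurable_selection mS S0; exists u => // t.
have := Su t; rewrite /S; case: ifPn => [_ [Uu /= fu]|/negP nG /= ->]; first by [].
by split => // Gt; exfalso; apply: nG; exact/mem_set.
Qed.

(** * Limits of trajectories *)

Lemma convex_set_comb (R : realType) (V : lmodType R) (A : set V) x y (k : R) :
  convex_set A -> 0 <= k -> k <= 1 -> A x -> A y -> A (k *: x + (1 - k) *: y).
Proof.
move=> cA k0 k1 Ax Ay.
by have := cA x y (Itv01 k0 k1) (mem_set Ax) (mem_set Ay); rewrite inE.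
Qed.

Lemma abs_continuous_sub (R : realType) (a b c d : R) (h : R -> 'rV[R]_7) :
  a <= c -> d <= b -> abs_continuous a b h -> abs_continuous c d h.
Proof.
move=> ac db ach e e0; have [m m0 hm] := ach e e0; exists m => // n s t st.
apply: hm => i; have [cs si td] := st i.
by split => //; [exact: le_trans cs|exact: le_trans db].
Qed.

Lemma lipschitz_abs_continuous (R : realType) (a b M : R) (h : R -> 'rV[R]_7) :
  0 < M -> (forall s t, `|h s - h t| <= M * `|s - t|) -> abs_continuous a b h.
Proof.
move=> M0 lh e e0; exists (e / M) => [|n s t st _]; first exact: divr_gt0.
rewrite ltr_pdivlMr// mulrC => H; apply: le_lt_trans H; rewrite mulr_sumr.
apply: ler_sum => i _; have [_ si _] := st i.
by rewrite (le_trans (lh _ _))// ger0_norm ?subr_ge0.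
Qed.

Section trajectories.
Context {R : realType} (f : 'rV[R]_7 -> R * R * R -> 'rV[R]_7) (Tmax tf : R).
Context (r0 : 'rV[R]_7) (M L : R).
Let U := ctrl_set Tmax.
Hypothesis M0 : 0 < M.
Hypothesis fM : forall y u, U u -> `|f y u| <= M.
Hypothesis L0 : 0 < L.
Hypothesis fL : forall y1 y2 u, U u -> `|f y1 u - f y2 u| <= L * `|y1 - y2|.

Lemma trajectory_mean_value ru (A : set 'rV[R]_7) (s t e : R) :
  trajectories f Tmax r0 tf ru -> - tf <= s -> s <= t -> t <= 0 ->
  (forall x y k, 0 <= k -> k <= 1 -> A x -> A y -> A (k *: x + (1 - k) *: y)) ->
  A !=set0 ->
  (forall x u, s <= x -> x <= t -> U u -> A (f (ru.1 x) u)) ->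
  0 < e -> exists2 z, A z & `|ru.1 t - ru.1 s - (t - s) *: z| <= e.
Proof.
move=> [[_ uU] acr aer _] tfs st t0 convA A0 fA e0.
apply: ac_mean_value => //; first exact: abs_continuous_sub acr.
apply: filterS aer; first exact: (ae_filter_ringOfSetsType lebesgue_measure).
move=> x H; rewrite in_itv/= => /andP[sx xt].
have x0 : x <= 0 by exact: le_trans t0.
exists (f (ru.1 x) (ru.2 x)); first by apply: fA => //; exact: uU.
by apply: H; rewrite in_itv/= x0 (le_trans tfs).
Qed.

(** The ball of radius [M] is convex and contains every velocity, so the mean value inclusion
    applies to it. The constant is common to all trajectories. *)
Lemma trajectory_lipschitz ru (s t : R) : trajectories f Tmax r0 tf ru ->
  s \in `[- tf, 0] -> t \in `[- tf, 0] ->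
  `|ru.1 s - ru.1 t| <= M * `|s - t|.
Proof.
move=> tr; wlog st : s t / s <= t.
  move=> H; have [/H//|/ltW/H H' si ti] := leP s t.
  by rewrite distrC (distrC s); exact: H'.
rewrite !in_itv/= => /andP[s1 _] /andP[_ t2].
rewrite distrC (distrC s) (ger0_norm (x := t - s)) ?subr_ge0//.
apply/ler_addgt0Pr => e e0.
have [|||z /= zM hz] := @trajectory_mean_value ru [set z | `|z| <= M] s t e
  tr s1 st t2 _ _ _ e0.
- move=> x y k k0 k1 /= xM yM; rewrite (le_trans (ler_normD _ _))// !normrZ.
  rewrite (ger0_norm k0) ger0_norm ?subr_ge0//.
  have -> : M = k * M + (1 - k) * M by ring.
  by apply: lerD; apply: ler_wpM2l; rewrite ?subr_ge0.
- by exists 0; rewrite /= normr0 ltW.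
- by move=> x u _ _ Uu /=; exact: fM.
rewrite -[ru.1 t - _](subrK ((t - s) *: z)) addrC (le_trans (ler_normD _ _))//.
by apply: lerD => //; rewrite normrZ ger0_norm ?subr_ge0// mulrC ler_wpM2r ?subr_ge0.
Qed.

Lemma limit_velocity (r : R -> 'rV[R]_7) (t : R) (d : 'rV[R]_7) :
  - tf < t -> t < 0 ->
  (forall e s, 0 < e -> s \in `[- tf, 0] ->
    exists ru, [/\ trajectories f Tmax r0 tf ru,
      `|ru.1 s - r s| < e & `|ru.1 t - r t| < e]) ->
  compact [set f (r t) u | u in U] -> convex_set [set f (r t) u | u in U] ->
  is_derive t 1 r d -> [set f (r t) u | u in U] d.
Proof.
move=> tft t0 approx cF vF dr; set F := [set _ | _ in _].
have clF : closed F by apply: compact_closed cF; exact: norm_hausdorff.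
apply: contrapT => nFd.
have /nbhs_ballP[e /= e0 deF] : nbhs d (~` F).
  by apply: open_nbhs_nbhs; split => //; exact: closed_openC.
(* [h *: (d - z)] will be a sum of five terms of norm at most [h * c], which is less than
   [h * e = 6 * (h * c)]. *)
pose c := e / 6; have c0 : 0 < c by rewrite divr_gt0.
have [p p0 hp] := is_derive_approx dr c0.
pose LM := 2 * (L * M); have LM0 : 0 < LM by rewrite !mulr_gt0.
(* The three bounds serve the expansion of [r] at [t], the inclusion [t + h <= 0], and
   [L * (M * h) <= c / 2]. With [L * m <= c / 2] below, the velocities of [q] on [[t, t + h]] are
   within [c] of [F]. *)
pose h := Num.min (p / 2) (Num.min (- t) (c / LM)).
have h0 : 0 < h by rewrite !lt_min !divr_gt0// oppr_gt0 t0.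
have hp' : h < p by rewrite /h gt_min; apply/orP; left; lra.
have ht : t + h <= 0.
  by rewrite -lerBrDl sub0r /h !ge_min lexx !orbT.
have hLM : L * (M * h) <= c / 2.
  have : h <= c / LM by rewrite /h !ge_min lexx !orbT.
  by rewrite ler_pdivlMr// /LM; lra.
pose m := Num.min (h * c) (c / (2 * L)).
have m0 : 0 < m by rewrite lt_min mulr_gt0// divr_gt0// mulr_gt0.
have mhc : m <= h * c by rewrite /m ge_min lexx.
have mL : L * m <= c / 2.
  have : m <= c / (2 * L) by rewrite /m ge_min lexx orbT.
  by rewrite ler_pdivlMr ?mulr_gt0//; lra.
have tI : t \in `[- tf, 0] by rewrite in_itv/= (ltW tft) (ltW t0).
have [|[q u] /= [tr qs qt]] := approx m (t + h) m0.
  by rewrite in_itv/= ht andbT (le_trans (ltW tft))// lerDl ltW.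
(* The [c]-neighbourhood of [F] inherits its convexity and contains the velocities of the nearby
   trajectory [q]. *)
pose A := [set y | exists2 z, F z & `|y - z| <= c].
have [||||y [z Fz yz] hy] := @trajectory_mean_value _ A t (t + h) (h * c) tr
  (ltW tft) _ ht _ _ _ (mulr_gt0 h0 c0).
- by rewrite lerDl ltW.
- move=> x y k k0 k1 [x' Fx' xx'] [y' Fy' yy'].
  exists (k *: x' + (1 - k) *: y'); first exact: convex_set_comb.
  rewrite opprD addrACA -!scalerBr (le_trans (ler_normD _ _))// !normrZ.
  rewrite (ger0_norm k0) ger0_norm ?subr_ge0//.
  have -> : c = k * c + (1 - k) * c by ring.
  by apply: lerD; apply: ler_wpM2l; rewrite ?subr_ge0.
- have [[_ uU] _ _ _] := tr.
  exists (f (r t) (u t)); exists (f (r t) (u t)).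
    by exists (u t) => //; apply: uU; exact: ltW.
  by rewrite subrr normr0 ltW.
- move=> x v tx xth Uv; exists (f (r t) v); first by exists v.
  rewrite (le_trans (fL _ _ Uv))//.
  have xI : x \in `[- tf, 0].
    by rewrite in_itv/= (le_trans (ltW tft) tx) (le_trans xth ht).
  have := trajectory_lipschitz tr xI tI; rewrite /= ger0_norm ?subr_ge0// => qxt.
  have : `|q x - r t| <= M * h + m.
    rewrite -(subrK (q t) (q x)) -addrA (le_trans (ler_normD _ _))//.
    apply: lerD; last exact: ltW.
    by apply: le_trans qxt _; rewrite ler_pM2l// lerBlDl.
  by rewrite -(ler_pM2l L0); lra.
apply: (deF z) => //; rewrite -ball_normE /ball_/=.
have := hp (t + h); rewrite addrC addKr (ger0_norm (ltW h0)) => /(_ hp') hr.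
rewrite [t + h - t]addrC addKr in hy.
rewrite -(ltr_pM2l h0) -[X in X * _ < _](gtr0_norm h0) -normrZ.
(* In order: the expansion of [r], the gaps between [r] and [q] at [t + h] and at [t], the mean
   value error for [q], and the distance from [y] to [F]. *)
have -> : h *: (d - z) = - (r (t + h) - r t - h *: d) + (r (t + h) - q (t + h))
    + (q t - r t) + (q (t + h) - q t - h *: y) + h *: (y - z).
  rewrite !scalerBr.
  move: (h *: d) (h *: z) (h *: y) (r (t + h)) (r t) (q (t + h)) (q t).
  move=> a b w r1 r2 q1 q2.
  rewrite !opprD !opprK !addrA.
  rewrite [RHS](ACl (3*12*(4*1)*(2*7)*(8*5)*(6*9)*(11*10)))/=.
  by rewrite !subrr !addr0.
have yzh : `|h *: (y - z)| <= h * c by rewrite normrZ (gtr0_norm h0) ler_pM2l.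
have hce : h * e = 6 * (h * c) by rewrite /c; field.
set v5 := h *: (y - z) in yzh *; set v4 := q (t + h) - _ - _ in hy *.
set v3 := q t - _; set v2 := r _ - q _; set v1 := - _.
have v1h : `|v1| <= h * c by rewrite /v1 normrN (mulrC h).
have v2h : `|v2| < m by rewrite /v2 distrC.
have v3h : `|v3| < m by [].
have := ler_normD (v1 + v2 + v3 + v4) v5.
have := ler_normD (v1 + v2 + v3) v4.
have := ler_normD (v1 + v2) v3.
have := ler_normD v1 v2.
have hc0 : 0 < h * c by rewrite mulr_gt0.
lra.
Qed.
End trajectories.

Lemma lipschitz_bound (R : realType) (V W : normedModType R) (g : V -> W) :
  lipschitz g -> exists2 L : R, 0 < L & forall x y, `|g x - g y| <= L * `|x - y|.
Proof.
move=> [M [_ lipM]]; exists (`|M| + 1); first by rewrite ltr_wpDl.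
move=> x y; apply: (lipM _ _ (x, y)) => //.
by rewrite (le_lt_trans (ler_norm M))// ltrDl.
Qed.

Lemma ctrl_set_compact (R : realType) (Tmax : R) : compact (ctrl_set Tmax).
Proof.
do 2 (apply: compact_setX; last exact: segment_compact).
exact: segment_compact.
Qed.

Lemma ctrl_set_nonempty (R : realType) (Tmax : R) :
  0 <= Tmax -> ctrl_set Tmax !=set0.
Proof.
move=> T0; exists (0, 0, 0); have := pi_ge0 R => p0.
by do 2?split; rewrite /= in_itv/= ?lexx//; apply/andP; split; lra.
Qed.

Lemma norm_ball_compact (R : realType) n (c : R) :
  compact [set y : 'rV[R]_n | `|y| <= c].
Proof.
apply: bounded_closed_compact.
  by exists c; split; [exact: num_real|move=> x cx y /= /le_trans; apply; exact: ltW].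
rewrite (_ : [set _ | _] = @Num.norm _ _ @^-1` `]-oo, c]%classic).
  by apply: closed_comp => [x _|]; [exact: norm_continuous|exact: interval_closed].
by apply/seteqP; split => y /=; rewrite in_itv.
Qed.

Lemma within_continuous_section (X Y Z : topologicalType) (U : set Y)
    (f : X -> Y -> Z) :
  {within [set: X] `*` U, continuous (fun p => f p.1 p.2)} ->
  forall x, {within U, continuous (f x)}.
Proof.
move=> /subspace_continuousP cf x; apply/subspace_continuousP => u Uu B Bfu.
have /= [[P Q] /= [Px Qu] PQ] := cf (x, u) (conj I Uu) B Bfu.
apply: filterS Qu => v Qv Uv; apply: (PQ (x, v)) => //.
by split => //=; exact: nbhs_singleton.
Qed.

(** A Borel preimage is a generator of the completed sigma-algebra, with empty null part. *)
Lemma measurable_fun_lebesgueR (R : realType) d (T : measurableType d)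
    (D : set R) (u : R -> T) : measurable D ->
  measurable_fun setT u ->
  measurable_fun (D : set (lebesgueR R)) (u : lebesgueR R -> T).
Proof.
move=> mD mu _ B mB; apply: sub_sigma_algebra.
exists (D `&` u @^-1` B).
  by apply: measurableI => //; rewrite -[X in measurable X]setTI; exact: mu.
by exists set0; [exact: negligible_set0|rewrite setU0].
Qed.

(** For [a <= b], the projection onto [[a, b]]: composing with it extends a curve to the whole line
    with the same Lipschitz constant. *)
Definition clamp (R : realType) (a b t : R) : R := Num.max a (Num.min t b).

Lemma clamp_itv (R : realType) (a b t : R) : a <= b -> clamp a b t \in `[a, b].
Proof.
by move=> ab; rewrite in_itv/= /clamp le_max lexx ge_max ab ge_min lexx orbT.
Qed.

Lemma clamp_id (R : realType) (a b t : R) : t \in `[a, b] -> clamp a b t = t.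
Proof. by rewrite in_itv/= => /andP[at' tb]; rewrite /clamp min_l// max_r. Qed.

Lemma clamp_contraction (R : realType) (a b s t : R) : a <= b ->
  `|clamp a b s - clamp a b t| <= `|s - t|.
Proof.
move=> ab; wlog st : s t / s <= t.
  by move=> H; have [/H//|/ltW/H] := leP s t; rewrite distrC (distrC t).
rewrite distrC (distrC s) /clamp.
rewrite (ger0_norm (x := t - s)) ?subr_ge0// ler_norml.
by case: (leP s b) => ?; case: (leP t b) => ?;
  do ?case: (leP a _) => ?; apply/andP; split; lra.
Qed.

Section limit_trajectories.
Context {R : realType} (f : 'rV[R]_7 -> R * R * R -> 'rV[R]_7) (Tmax tf : R).
Context (r0 : 'rV[R]_7) (M L : R).
Let U := ctrl_set Tmax.
Hypothesis Tmax0 : 0 <= Tmax.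
Hypothesis tf0 : 0 <= tf.
Hypothesis M0 : 0 < M.
Hypothesis fM : forall y u, U u -> `|f y u| <= M.
Hypothesis L0 : 0 < L.
Hypothesis fL : forall y1 y2 u, U u -> `|f y1 u - f y2 u| <= L * `|y1 - y2|.

(** The clamped trajectories share the Lipschitz constant [M] and the initial state, so they stay in
    the ball of radius [|r0| + M * tf], compact in finite dimension; the Lipschitz bound passes to
    the limit. *)
Lemma limit_trajectory (w : nat -> (R -> 'rV[R]_7) * (R -> R * R * R)) :
  (forall n, trajectories f Tmax r0 tf (w n)) ->
  exists r : R -> 'rV[R]_7, [/\ forall s t, `|r s - r t| <= M * `|s - t|,
    r (- tf) = r0 &
    forall e s t N, 0 < e -> s \in `[- tf, 0] -> t \in `[- tf, 0] ->
      exists n, [/\ (N <= n)%N, `|(w n).1 s - r s| < e & `|(w n).1 t - r t| < e]].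
Proof.
move=> tr; have tf0' : - tf <= 0 by rewrite oppr_le0.
pose k := clamp (- tf) 0; pose q n t := (w n).1 (k t).
have kI t : k t \in `[- tf, 0] by exact: clamp_itv.
have aI : - tf \in `[- tf, 0] by rewrite in_itv/= lexx.
have qL n s t : `|q n s - q n t| <= M * `|s - t|.
  apply: le_trans (trajectory_lipschitz M0 fM (tr n) (kI s) (kI t)) _.
  by rewrite ler_pM2l//; exact: clamp_contraction.
have qa n : q n (- tf) = r0 by have [_ _ _] := tr n; rewrite /q /k clamp_id.
have qK n t : `|q n t| <= `|r0| + M * tf.
  rewrite -(subrK r0 (q n t)) addrC (le_trans (ler_normD _ _))// lerD2l -(qa n).
  rewrite /q {2}/k clamp_id//.
  apply: le_trans (trajectory_lipschitz M0 fM (tr n) (kI t) aI) _.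
  rewrite ler_pM2l//; have := kI t; rewrite in_itv/= => /andP[? ?].
  by rewrite ger0_norm; lra.
have [r rq] := pointwise_cluster (@norm_ball_compact R 7 (`|r0| + M * tf)) qK.
exists r; split.
- move=> s t; apply/ler_addgt0Pr => e e0.
  have e20 : 0 < e / 2 by rewrite divr_gt0.
  have [n [_ qs qt]] := rq _ s t 0%N e20.
  have -> : r s - r t = - (q n s - r s) + (q n s - q n t) + (q n t - r t).
    by rewrite opprB !addrA subrK subrK.
  have := ler_normD (- (q n s - r s) + (q n s - q n t)) (q n t - r t).
  have := ler_normD (- (q n s - r s)) (q n s - q n t).
  by have := qL n s t; rewrite normrN; lra.
- apply/eqP; rewrite -subr_eq0 -normr_le0; apply/ler_addgt0Pr => e e0; rewrite add0r.
  have [n [_ qs _]] := rq _ (- tf) 0 0%N e0.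
  by rewrite -(qa n) distrC ltW.
- move=> e s t N e0 sI tI; have [n [Nn qs qt]] := rq e s t N e0.
  by exists n; move: qs qt; rewrite /q /k !clamp_id.
Qed.

Lemma limit_trajectory_control (r : R -> 'rV[R]_7) :
  (forall y, {within U, continuous (f y)}) ->
  (forall t, t \in `[- tf, 0] -> compact [set f (r t) u | u in U] /\
     convex_set [set f (r t) u | u in U]) ->
  (forall s t, `|r s - r t| <= M * `|s - t|) -> r (- tf) = r0 ->
  (forall e s t, 0 < e -> s \in `[- tf, 0] -> t \in `[- tf, 0] ->
    exists ru, [/\ trajectories f Tmax r0 tf ru,
      `|ru.1 s - r s| < e & `|ru.1 t - r t| < e]) ->
  exists u, trajectories f Tmax r0 tf (r, u).
Proof.
move=> cf vf rL ra approx.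
have [N [mN N0 dN]] := lipschitz_rV_ae_derivable M0 rL.
(* [N] is a measurable null set containing all points of nondifferentiability, so [G] is measurable
   and misses only a null part of [[- tf, 0]]. *)
pose G : set R := `]- tf, 0[%classic `\` N.
have mG : measurable G by apply: measurableD => //; exact: measurable_itv.
have dG t : G t -> derivable r t 1.
  by move=> [_ Nt]; apply: contrapT => nd; apply: Nt; exact: dN.
have velG t : G t -> [set f (r t) u | u in U] ('D_1 r t).
  move=> Gt; have [+ _] := Gt; rewrite /= in_itv/= => /andP[tft t0].
  have tI : t \in `[- tf, 0] by rewrite in_itv/= (ltW tft) (ltW t0).
  have [cF vF] := vf t tI.
  apply: (limit_velocity M0 fM L0 fL tft t0 _ cF vF); last exact/derivableP/dG.
  by move=> e s e0 sI; exact: approx.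
have [u mu Uu] := measurable_velocity_selection (@ctrl_set_compact R Tmax)
  (ctrl_set_nonempty Tmax0) cf fL (ltW L0) rL mG dG velG.
exists u; split => //=.
- split; last by move=> t _; have [] := Uu t.
  by apply: measurable_fun_lebesgueR => //; exact: measurable_itv.
- exact: lipschitz_abs_continuous M0 rL.
- have n1 (a : R) : lebesgue_measure.-negligible [set a].
    by exists [set a]; split; [exact: measurable_set1|exact: lebesgue_measure_set1|].
  have nN : lebesgue_measure.-negligible N by exists N; split.
  apply: negligibleS (negligibleU nN (negligibleU (n1 (- tf)) (n1 0))).
  move=> t /= /not_implyP[]; rewrite in_itv/= => /andP[tft t0] nd.
    have [Nt|Nt] := pselect (N t); first by left.
    right; apply: contrapT => /not_orP[/= ta tb]; apply: nd.
    have Gt : G t.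
      split => //=; rewrite in_itv/= !lt_neqAle tft t0 !andbT.
      by rewrite eq_sym; apply/andP; split; apply/eqP.
    have [_ /(_ Gt) ->] := Uu t; exact/derivableP/dG.
Qed.
End limit_trajectories.

(** * Sublevel set of [omega] and equivalence of the constraints *)

(** The infimum is below [e], so some trajectory costs less than [e]; its running maximum is
    attained and bounds [g] at every time. *)
Lemma omega_le0_trajectory (R : realType) (f : 'rV[R]_7 -> R * R * R -> 'rV[R]_7)
    (Tmax : R) (g nu : 'rV[R]_7 -> R) (r0 : 'rV[R]_7) (tf e : R) :
  0 <= tf -> lipschitz g -> (omega f Tmax g nu r0 tf <= 0)%E -> 0 < e ->
  exists ru, [/\ trajectories f Tmax r0 tf ru, nu (ru.1 0) < e &
    forall t, t \in `[- tf, 0] -> g (ru.1 t) < e].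
Proof.
move=> tf0 lg om e0.
have /ereal_inf_lt[_ [ru tr <-]] : (omega f Tmax g nu r0 tf < e%:E)%E.
  by apply: le_lt_trans om _; rewrite lte_fin.
rewrite lte_fin gt_max => /andP[nue ge]; exists ru; split => // t tI.
have [_ acr _ _] := tr.
have [c _ [rmc gc]] := running_max_attained tf0 lg acr.
by apply: le_lt_trans (gc t tI) _; rewrite -rmc.
Qed.

Lemma omega_le0 (R : realType) (f : 'rV[R]_7 -> R * R * R -> 'rV[R]_7)
    (Tmax : R) (g nu : 'rV[R]_7 -> R) (r0 : 'rV[R]_7) (tf : R) ru :
  0 <= tf -> trajectories f Tmax r0 tf ru -> nu (ru.1 0) <= 0 ->
  (forall t, t \in `[- tf, 0] -> g (ru.1 t) <= 0) ->
  (omega f Tmax g nu r0 tf <= 0)%E.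
Proof.
move=> tf0 tr nu0 g0; apply: ereal_inf_le.
exists (Num.max (nu (ru.1 0)) (running_max g tf ru.1))%:E; first by exists ru.
rewrite lee_fin ge_max nu0/=; apply: ge_sup.
  by exists (g (ru.1 0)), 0; rewrite //= in_itv/= lexx oppr_le0 tf0.
by move=> _ [t tI <-]; exact: g0.
Qed.

Lemma le0_of_approx (R : realType) (V : normedModType R) (p : V -> R) (v : V) :
  lipschitz p -> (forall e, 0 < e -> exists x, p x <= e /\ `|x - v| < e) -> p v <= 0.
Proof.
move=> /lipschitz_bound[L L0 lp] approx; apply/ler_addgt0Pr => e e0; rewrite add0r.
have L10 : 0 < 1 + L by rewrite addr_gt0.
(* The tolerance [e / (1 + L)] counts once for [p x] and [L] times for the distance to [v], [e] in
   total. *)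
have [x [pxe xv]] := approx (e / (1 + L)) (divr_gt0 e0 L10).
have := lp v x; rewrite distrC (distrC v) ler_distlC => /andP[_].
have : L * `|x - v| <= L * (e / (1 + L)) by rewrite ler_pM2l// ltW.
have -> : L * (e / (1 + L)) = e - e / (1 + L) by field; rewrite gt_eqF.
lra.
Qed.

Theorem theorem4p1 (R : realType)
  (Tmax rho_min rho_max m_min m_max : R)
  (f : 'rV[R]_7 -> R * R * R -> 'rV[R]_7)
  (C Init : set 'rV[R]_7) (g nu : 'rV[R]_7 -> R)
  (U := ctrl_set Tmax) (K := state_set rho_min rho_max m_min m_max)
  (Tmax_gt0 : 0 < Tmax)
  (rho_bounds : 0 < rho_min < rho_max)
  (m_bounds : 0 = m_min /\ m_min < m_max)
  (f_cont : {within [set: 'rV[R]_7] `*` U, continuous (fun x => f x.1 x.2)})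
  (f_bounded : [bounded f x.1 x.2 | x in [set: 'rV[R]_7] `*` U])
  (f_lipschitz : exists2 Lf : R, 0 < Lf &
     forall r1 r2 u, U u -> `|f r1 u - f r2 u| <= Lf * `|r1 - r2|)
  (f_convex : forall r, K r ->
     compact [set f r u | u in U] /\ convex_set [set f r u | u in U])
  (C_closed : closed C) (C_sub : C `<=` K)
  (Init_closed : closed Init) (Init_sub : Init `<=` K)
  (g_lipschitz : lipschitz g) (nu_lipschitz : lipschitz nu)
  (g_level : forall r, g r <= 0 <-> K r)
  (nu_level : forall r, nu r <= 0 <-> C r) :
  same_problem (problemP f Tmax K C Init) (problemP' f Tmax g nu Init) /\
  forall (r0 : 'rV[R]_7) (tf : R), Init r0 -> 0 <= tf ->
    (Gamma f Tmax K C (r0, tf) <-> (omega f Tmax g nu r0 tf <= 0)%E).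
Proof.
have equiv (r0 : 'rV[R]_7) (tf : R) : 0 <= tf ->
    (Gamma f Tmax K C (r0, tf) <-> (omega f Tmax g nu r0 tf <= 0)%E).
  move=> tf0; split.
    move=> [_ [ru [tr [Kr Cr]]]]; apply: omega_le0 tr _ _ => //.
      exact/nu_level.
    by move=> t tI; apply/g_level; exact: Kr.
  move=> om; split => //=.
  have [Lf Lf0 fL] := f_lipschitz.
  have [M M0 fM] : exists2 M : R, 0 < M & forall y u, U u -> `|f y u| <= M.
    case: f_bounded => B [_ fB]; exists (`|B| + 1); first by rewrite ltr_wpDl.
    move=> y u Uu; apply: (fB _ _ (y, u)); last by split.
    by rewrite (le_lt_trans (ler_norm B))// ltrDl.
  have inv0 n : 0 < n.+1%:R^-1 :> R by rewrite invr_gt0.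
  (* A minimizing sequence, with [nu] at the end and [g] along the n-th trajectory below
     [1 / (n + 1)]. *)
  have [w wP] := choice (fun n => omega_le0_trajectory tf0 g_lipschitz om (inv0 n)).
  have wtr n : trajectories f Tmax r0 tf (w n) by have [] := wP n.
  have [r [rL ra rw]] := limit_trajectory tf0 M0 fM wtr.
  have small e t : 0 < e -> t \in `[- tf, 0] ->
      exists n, n.+1%:R^-1 < e /\ `|(w n).1 t - r t| < e.
    move=> e0 tI.
    have [N _ HN] := near_infty_natSinv_lt (PosNum e0).
    have [n [Nn wt _]] := rw e t t N e0 tI tI.
    by exists n; split => //; exact: HN.
  (* The limit lies in [K] exactly, so compactness and convexity of the velocity sets hold along
     it. *)
  have Kr t : t \in `[- tf, 0] -> K (r t).
    move=> tI; apply/g_level/(le0_of_approx g_lipschitz) => e e0.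
    have [n [ne wt]] := small e t e0 tI; exists ((w n).1 t); split => //.
    by have [_ _ /(_ t tI) gt] := wP n; apply/ltW/(lt_trans gt).
  have Cr : C (r 0).
    apply/nu_level/(le0_of_approx nu_lipschitz) => e e0.
    have [|n [ne wt]] := small e 0 e0; first by rewrite in_itv/= lexx oppr_le0 tf0.
    exists ((w n).1 0); split => //.
    by have [_ nut _] := wP n; apply/ltW/(lt_trans nut).
  have [|||u tru] :=
      limit_trajectory_control (ltW Tmax_gt0) M0 fM Lf0 fL (r := r) _ _ rL ra.
  - exact: within_continuous_section.
  - by move=> t tI; exact/f_convex/Kr.
  - move=> e s t e0 sI tI; have [n [_ ws wt]] := rw e s t 0%N e0 sI tI.
    by exists (w n).
  by exists (r, u).
split; last by move=> r0 tf _; exact: equiv.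
split; first by [].
by apply/seteqP; split => -[r0 tf] /= [[Ir tf0] H]; split => //; apply/(equiv _ _ tf0).
Qed.
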